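(* Let $(W,\star,\circ)$ be a commutative wire, and let $(B(W),\circ)$ denote the Grothendieck group of the commutative monoid $(W,\circ)$. On $B(W)$, define the operation $$\frac{u}{v}\star\frac{u_1}{v_1}=\frac{(u\circ v_1)\star(v\circ v_1)^{-1}\star(u_1\circ v)}{v\circ v_1}.$$ Then $(B(W),\star,\circ)$ is a commutative skew brace (in particular, $\star$ is well defined on $B(W)$).
   Context: A wire is a triple $(W,\star,\circ)$ with $(W,\star)$ a group, $(W,\circ)$ a semigroup, and $a\circ(b\star c)=(a\circ b)\star a^{-1}\star(a\circ c)$, $(b\star c)\circ a=(b\circ a)\star a^{-1}\star(c\circ a)$ for all $a,b,c\in W$, where $a^{-1}$ is the inverse with respect to $\star$. Then $(W,\circ)$ is a monoid whose neutral element is the neutral element $e$ of $\star$. A wire is commutative if $\circ$ is commutative. A skew brace is a triple $(B,\star,\circ)$ such that $(B,\star)$ and $(B,\circ)$ are groups and $a\circ(b\star c)=(a\circ b)\star a^{-1}\star(a\circ c)$ for all $a,b,c\in B$. It is commutative if $\circ$ is commutative. The Grothendieck group of a commutative monoid $(M,\circ)$ is $(M\times M)/\sim$, where $(u,v)\sim(u_1,v_1)$ if and only if there is $k\in M$ with $u\circ v_1\circ k=u_1\circ v\circ k$; writing $\frac{u}{v}$ for the class of $(u,v)$, the group operation is $\frac{u}{v}\circ\frac{u_1}{v_1}=\frac{u\circ u_1}{v\circ v_1}$. *)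

(* Defs.v *)
From HB Require Import structures.
From mathcomp Require Import all_boot.
From mathcomp Require Import generic_quotient.
From mathcomp Require Import boolp.

Set Implicit Arguments.
Unset Strict Implicit.
Unset Printing Implicit Defensive.

Local Open Scope quotient_scope.

(* Wires and skew braces carry two unrelated operations on the same type, so
   group structures are attached here to an operation (as with [Monoid.law])
   and not, as with [groupType], to the carrier. *)
Record group_law (T : Type) := GroupLaw {
  gop :> T -> T -> T;
  gone : T;
  ginv : T -> T;
  gopA : associative gop;
  gop1x : left_id gone gop;
  gopx1 : right_id gone gop;
  gopVx : left_inverse gone ginv gop;
  gopxV : right_inverse gone ginv gop
}.

Record wire := Wire {
  wire_sort :> Type;
  wstar : group_law wire_sort;
  wcirc : wire_sort -> wire_sort -> wire_sort;
  wcircA : associative wcirc;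
  wcircDr : forall a b c,
    wcirc a (wstar b c)
      = wstar (wstar (wcirc a b) (ginv wstar a)) (wcirc a c);
  wcircDl : forall a b c,
    wcirc (wstar b c) a
      = wstar (wstar (wcirc b a) (ginv wstar a)) (wcirc c a)
}.

Arguments wstar {w}.
Arguments wcirc {w}.

Record com_wire := ComWire {
  com_wire_wire :> wire;
  wcircC : commutative (@wcirc com_wire_wire)
}.

Definition is_skew_brace (B : Type) (star circ : group_law B) : Prop :=
  forall a b c : B,
    circ a (star b c) = star (star (circ a b) (ginv star a)) (circ a c).

Definition is_com_skew_brace (B : Type) (star circ : group_law B) : Prop :=
  is_skew_brace star circ /\ commutative circ.

Section WireUnit.
Variable W : wire.
Let e : W := gone wstar.

Lemma wire_unit_aux (x a : W) : x = wstar (wstar x (ginv wstar a)) x -> x = a.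
Proof.
move=> h.
have {}h : wstar (ginv wstar a) x = e.
  rewrite -[LHS](gop1x wstar) -(gopVx wstar x) -(gopA wstar).
  by rewrite (gopA wstar x) -h gopVx.
by rewrite -[LHS](gop1x wstar) -(gopxV wstar a) -(gopA wstar) h gopx1.
Qed.

Lemma wcircx1 : right_id e wcirc.
Proof. by move=> a; apply: wire_unit_aux; rewrite -wcircDr gop1x. Qed.

Lemma wcirc1x : left_id e wcirc.
Proof. by move=> a; apply: wire_unit_aux; rewrite -wcircDl gop1x. Qed.

End WireUnit.

Definition wcirc_com_law (W : com_wire) : Monoid.com_law (gone (@wstar W)) :=
  HB.pack (@wcirc W)
    (Monoid.isComLaw.Build W (gone wstar) (@wcirc W)
       (@wcircA W) (@wcircC W) (@wcirc1x W)).

Section Grothendieck.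
Variables (M : Type) (e : M) (op : Monoid.com_law e).

(* [{eq_quot _}] requires a choiceType and a boolean relation, whence
   [{classic _}] and [`[< _ >]]. *)
Definition groth_rel : rel {classic M * M} := fun x y =>
  `[< exists k : M, op (op x.1 y.2) k = op (op y.1 x.2) k >].

Lemma groth_rel_refl : reflexive groth_rel.
Proof. by move=> x; apply/asboolP; exists e. Qed.

Lemma groth_rel_sym : symmetric groth_rel.
Proof. by move=> x y; apply/asboolP/asboolP => -[k hk]; exists k. Qed.

Lemma groth_rel_trans : transitive groth_rel.
Proof.
move=> [b b'] [a a'] [c c'] /asboolP[k /= hk] /asboolP[l /= hl].
apply/asboolP; exists (op (op b b') (op k l)) => /=.
rewrite [LHS](AC (2*(2*2)) ((1*4*5)*(3*2*6))) hk hl.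
by rewrite [LHS](AC (3*3) ((4*2)*((1*5)*(3*6)))).
Qed.

Canonical groth_equiv :=
  EquivRel groth_rel groth_rel_refl groth_rel_sym groth_rel_trans.

Definition groth : Type := {eq_quot groth_equiv}.

(* the class u/v *)
Definition frac (u v : M) : groth :=
  \pi_({eq_quot groth_equiv}) ((u, v) : {classic M * M}).

Lemma fracP (u v u1 v1 : M) :
  frac u v = frac u1 v1 <-> exists k : M, op (op u v1) k = op (op u1 v) k.
Proof. by split=> [/eqmodP/asboolP | h] //; apply/eqmodP/asboolP. Qed.

Lemma frac_surj (x : groth) : exists u v, x = frac u v.
Proof.
by exists (repr (x : {eq_quot groth_equiv})).1,
          (repr (x : {eq_quot groth_equiv})).2; rewrite /frac -surjective_pairing reprK.
Qed.

(* On representatives; [groth_mulE] gives the formula on arbitrary fractions. *)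
Definition groth_mul (x y : groth) : groth :=
  let a := repr (x : {eq_quot groth_equiv}) in
  let b := repr (y : {eq_quot groth_equiv}) in
  frac (op a.1 b.1) (op a.2 b.2).

Definition groth_inv (x : groth) : groth :=
  let a := repr (x : {eq_quot groth_equiv}) in frac a.2 a.1.

Lemma repr_frac u v : let a := repr (frac u v : {eq_quot groth_equiv}) in
  exists k, op (op a.1 v) k = op (op u a.2) k.
Proof. by apply/fracP; rewrite /frac -surjective_pairing reprK. Qed.

Lemma groth_mulE u v u1 v1 :
  groth_mul (frac u v) (frac u1 v1) = frac (op u u1) (op v v1).
Proof.
rewrite /groth_mul; have /= := repr_frac u v; have /= := repr_frac u1 v1.
case: (repr _) => [c d] /= [l hl]; case: (repr _) => [a b] /= [k hk].
apply/fracP; exists (op k l).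
rewrite [LHS](AC (2*2*2) ((1*3*5)*(2*4*6))) hk hl.
by rewrite [LHS](AC (3*3) ((1*4*(2*5))*(3*6))).
Qed.

Lemma groth_invE u v : groth_inv (frac u v) = frac v u.
Proof.
rewrite /groth_inv; have /= := repr_frac u v.
case: (repr _) => [a b] /= [k hk]; apply/fracP; exists k.
by rewrite (Monoid.mulmC op b) (Monoid.mulmC op v).
Qed.

Lemma groth_mulA : associative groth_mul.
Proof.
move=> x y z; have [a [b ->]] := frac_surj x; have [c [d ->]] := frac_surj y.
by have [f [g ->]] := frac_surj z; rewrite !groth_mulE !Monoid.mulmA.
Qed.

Lemma groth_mulC : commutative groth_mul.
Proof.
move=> x y; have [a [b ->]] := frac_surj x; have [c [d ->]] := frac_surj y.
by rewrite !groth_mulE (Monoid.mulmC op a) (Monoid.mulmC op b).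
Qed.

Lemma groth_mul1x : left_id (frac e e) groth_mul.
Proof.
by move=> x; have [a [b ->]] := frac_surj x; rewrite groth_mulE !Monoid.mul1m.
Qed.

Lemma groth_mulx1 : right_id (frac e e) groth_mul.
Proof. by move=> x; rewrite groth_mulC groth_mul1x. Qed.

Lemma groth_mulVx : left_inverse (frac e e) groth_inv groth_mul.
Proof.
move=> x; have [a [b ->]] := frac_surj x; rewrite groth_invE groth_mulE.
by apply/fracP; exists e; rewrite !(Monoid.mulm1, Monoid.mul1m) Monoid.mulmC.
Qed.

Lemma groth_mulxV : right_inverse (frac e e) groth_inv groth_mul.
Proof. by move=> x; rewrite groth_mulC groth_mulVx. Qed.

Definition groth_law : group_law groth :=
  GroupLaw groth_mulA groth_mul1x groth_mulx1 groth_mulVx groth_mulxV.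

End Grothendieck.

(* Main.v *)
(* The ternary operation [a * c^-1 * b] of the group [(W, star)] is preserved by
    every translation of [(W, circ)].  Hence it commutes with expansion of
    fractions, and over a common denominator [star] reads
    [a/d * b/d = (a * d^-1 * b)/d]: the group structure of [W] with its neutral
    element moved to [d].  All the axioms are then checked over a common
    denominator. *)

Require Import Defs.
From mathcomp Require Import all_boot.
From mathcomp Require Import generic_quotient.
From mathcomp Require Import boolp.

Set Implicit Arguments.
Unset Strict Implicit.
Unset Printing Implicit Defensive.

Local Open Scope quotient_scope.

Section GroupLaw.
Variables (T : Type) (g : group_law T).

Lemma gopK (a : T) : cancel (g a) (g (ginv g a)).
Proof. by move=> b; rewrite gopA gopVx gop1x. Qed.

Lemma gopKV (a : T) : cancel (g (ginv g a)) (g a).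
Proof. by move=> b; rewrite gopA gopxV gop1x. Qed.

Definition gtern (a c b : T) : T := g (g a (ginv g c)) b.

(** From here to [gternxV]: the group axioms of [gtern _ d _] for a fixed [d], which is the neutral
    element, the inverse of [a] being [gtern d a d]. *)
Lemma gternA (a b c d : T) :
  gtern (gtern a d b) d c = gtern a d (gtern b d c).
Proof. by rewrite /gtern -!gopA. Qed.

Lemma gtern1x (a b : T) : gtern a a b = b.
Proof. by rewrite /gtern gopxV gop1x. Qed.

Lemma gternx1 (a b : T) : gtern a b b = a.
Proof. by rewrite /gtern -gopA gopVx gopx1. Qed.

Lemma gternVx (a d : T) : gtern (gtern d a d) d a = d.
Proof. by rewrite /gtern -!gopA gopKV gopVx gopx1. Qed.

Lemma gternxV (a d : T) : gtern a d (gtern d a d) = d.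
Proof. by rewrite /gtern -!gopA gopK gopKV. Qed.

(** Read in the group with neutral element [d], the left side is again [a * c^-1 * b]: the ternary
    operation does not depend on the base point. *)
Lemma gtern_translate (a b c d : T) :
  gtern (gtern a d (gtern d c d)) d b = gtern a c b.
Proof. by rewrite /gtern -!gopA gopK gopKV. Qed.

End GroupLaw.

Section Wire.
Variable W : wire.

Lemma wcirc_inv (k c : W) :
  wcirc k (ginv wstar c) = wstar k (wstar (ginv wstar (wcirc k c)) k).
Proof.
(* Distributivity applied to [c * c^-1], whose image is [k] because the two operations share their
   neutral element. *)
have h : wstar (wstar (wcirc k c) (ginv wstar k)) (wcirc k (ginv wstar c)) = k.
  by rewrite -wcircDr gopxV wcircx1.
by rewrite -[X in _ = wstar _ (wstar _ X)]h -!gopA gopK gopKV.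
Qed.

(** The two correction factors [k^-1] from distributivity cancel against the two [k] produced by
    [wcirc_inv]. *)
Lemma wcirc_gtern (k a c b : W) :
  wcirc k (gtern wstar a c b)
    = gtern wstar (wcirc k a) (wcirc k c) (wcirc k b).
Proof. by rewrite /gtern !wcircDr wcirc_inv -!gopA gopK gopKV. Qed.

End Wire.

Section Fractions.
Variables (M : Type) (e : M) (op : Monoid.com_law e).

Lemma frac_expand (k u v : M) : frac op (op u k) (op v k) = frac op u v.
Proof.
by apply/fracP; exists e; rewrite [LHS](AC ((2*1)*1) ((1*(3*2))*4)).
Qed.

Lemma repr_fracE (u v : M) : exists p q k,
  repr (frac op u v : {eq_quot groth_equiv op}) = (p, q)
  /\ op (op p v) k = op (op u q) k.
Proof.
have /= := repr_frac op u v; case: (repr _) => [p q] /= [k hk].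
by exists p, q, k.
Qed.

Lemma frac_common2 (x y : groth op) :
  exists a b d, x = frac op a d /\ y = frac op b d.
Proof.
have [u [v ->]] := frac_surj x; have [u1 [v1 ->]] := frac_surj y.
exists (op u v1), (op u1 v), (op v v1).
by rewrite frac_expand (Monoid.mulmC op v v1) frac_expand.
Qed.

Lemma frac_common3 (x y z : groth op) :
  exists a b c d, [/\ x = frac op a d, y = frac op b d & z = frac op c d].
Proof.
have [a [b [d [-> ->]]]] := frac_common2 x y; have [u [v ->]] := frac_surj z.
exists (op a v), (op b v), (op u d), (op d v).
by rewrite !frac_expand (Monoid.mulmC op d v) frac_expand.
Qed.

(** Puts the neutral element over whatever denominator the other fraction has. *)
Lemma frac_diag (d : M) : frac op d d = frac op e e.
Proof. by apply/fracP; exists e; rewrite !Monoid.mulm1 Monoid.mul1m. Qed.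

End Fractions.

Section GrothendieckStar.
Variable W : com_wire.

Local Notation op := (wcirc_com_law W).
Local Notation tern := (gtern (@wstar W)).
Local Notation B := (groth op).

Lemma op_gtern (k a c b : W) :
  op (tern a c b) k = tern (op a k) (op c k) (op b k).
Proof. by rewrite !(Monoid.mulmC op _ k); apply: wcirc_gtern. Qed.

Definition groth_star (x y : B) : B :=
  let a := repr (x : {eq_quot groth_equiv op}) in
  let b := repr (y : {eq_quot groth_equiv op}) in
  frac op (tern (op a.1 b.2) (op a.2 b.2) (op b.1 a.2)) (op a.2 b.2).

Definition groth_star_inv (x : B) : B :=
  let a := repr (x : {eq_quot groth_equiv op}) in
  frac op (tern a.2 a.1 a.2) a.2.

(** This carries the well-definedness of [groth_star], which is computed on chosen
    representatives. *)
Lemma groth_star_common (a b d : W) :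
  groth_star (frac op a d) (frac op b d) = frac op (tern a d b) d.
Proof.
have [p [q [k [ra hk]]]] := repr_fracE op a d.
have [r [s [l [rb hl]]]] := repr_fracE op b d.
rewrite /groth_star ra rb /fst /snd.
(* With all factors moved inside [tern], the three arguments agree separately: the first by [hk],
   the last by [hl], the middle one by rearrangement alone. *)
apply/fracP; exists (op k l); rewrite !op_gtern; congr (gtern _ _ _ _).
- rewrite [LHS](AC (2*1*2) ((1*3*4)*(2*5))) [RHS](AC (1*2*2) ((1*2*4)*(3*5))).
  by rewrite -hk.
- by rewrite [LHS](AC (2*1*2) ((3*(1*2))*(4*5))).
- rewrite [LHS](AC (2*1*2) ((1*3*5)*(2*4))) [RHS](AC (1*2*2) ((1*3*5)*(2*4))).
  by rewrite -hl.
Qed.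

Lemma groth_starE (u v u1 v1 : W) :
  groth_star (frac op u v) (frac op u1 v1)
    = frac op (tern (op u v1) (op v v1) (op u1 v)) (op v v1).
Proof.
rewrite -groth_star_common frac_expand.
by rewrite (Monoid.mulmC op v v1) frac_expand.
Qed.

Lemma groth_star_invE (u v : W) :
  groth_star_inv (frac op u v) = frac op (tern v u v) v.
Proof.
have [p [q [k [r hk]]]] := repr_fracE op u v.
rewrite /groth_star_inv r /fst /snd; apply/fracP; exists k.
by rewrite !op_gtern hk (Monoid.mulmC op v q).
Qed.

Lemma groth_starA : associative groth_star.
Proof.
move=> x y z; have [a [b [c [d [-> -> ->]]]]] := frac_common3 x y z.
by rewrite !groth_star_common gternA.
Qed.

Lemma groth_star1x : left_id (frac op (gone wstar) (gone wstar)) groth_star.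
Proof.
move=> x; have [a [d ->]] := frac_surj x.
by rewrite -(frac_diag op d) groth_star_common gtern1x.
Qed.

Lemma groth_starx1 : right_id (frac op (gone wstar) (gone wstar)) groth_star.
Proof.
move=> x; have [a [d ->]] := frac_surj x.
by rewrite -(frac_diag op d) groth_star_common gternx1.
Qed.

Lemma groth_starVx :
  left_inverse (frac op (gone wstar) (gone wstar)) groth_star_inv groth_star.
Proof.
move=> x; have [a [d ->]] := frac_surj x.
by rewrite groth_star_invE groth_star_common gternVx frac_diag.
Qed.

Lemma groth_starxV :
  right_inverse (frac op (gone wstar) (gone wstar)) groth_star_inv groth_star.
Proof.
move=> x; have [a [d ->]] := frac_surj x.
by rewrite groth_star_invE groth_star_common gternxV frac_diag.
Qed.

Definition groth_star_law : group_law B :=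
  GroupLaw groth_starA groth_star1x groth_starx1 groth_starVx groth_starxV.

Lemma groth_star_skew_brace : is_skew_brace groth_star_law (groth_law op).
Proof.
move=> x y z /=; have [p [q ->]] := frac_surj x.
have [b [c [d [-> ->]]]] := frac_common2 y z.
(* The products have denominator [q d], so the remaining [p/q], under the inverse, is expanded to
   [pd/qd]. The numerators then to be compared are the two sides of [wcirc_gtern]. *)
rewrite groth_star_common !groth_mulE -(frac_expand op d p q).
rewrite groth_star_invE !groth_star_common gtern_translate.
by congr (frac _ _ _); apply: wcirc_gtern.
Qed.

End GrothendieckStar.

Theorem proposition2p23 (W : com_wire) :
  exists bstar : group_law (groth (wcirc_com_law W)),
    (forall u v u1 v1 : W,
       bstar (frac (wcirc_com_law W) u v) (frac (wcirc_com_law W) u1 v1)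
       = frac (wcirc_com_law W)
           (wstar (wstar (wcirc u v1) (ginv wstar (wcirc v v1))) (wcirc u1 v))
           (wcirc v v1))
    /\ is_com_skew_brace bstar (groth_law (wcirc_com_law W)).
Proof.
exists (groth_star_law W); split; first exact: groth_starE.
by split; [apply: groth_star_skew_brace | apply: groth_mulC].
Qed.
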